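(* For every integer $m\ge 2$, the digraph $\mathcal D^*_m$ is disconnected, and each of its (weakly connected) components is a strongly connected digraph.
   Context: Digraph $\mathcal D_m$: let $\mathcal D_{ud}$ be the digraph on $\{a,b,c,d,e,f\}$ with arcs from each of $a,b,d$ to each of $b,c,f$, and from each of $c,e,f$ to each of $a,d,e$; let $\mathcal D_{lr}$ be the digraph on the same letters with arcs from each of $a,c,e$ to each of $d,e,f$, and from each of $b,d,f$ to each of $a,b,c$. $V(\mathcal D_m)$ is the set of words $\alpha_1\cdots\alpha_m$ over $\{a,b,c,d,e,f\}$ with $\alpha_1\in\{a,d,e\}$, $\alpha_m\in\{c,e,f\}$ and each $(\alpha_i,\alpha_{i+1})$, $1\le i\le m-1$, an arc of $\mathcal D_{ud}$. There is an arc $\alpha_1\cdots\alpha_m\to\beta_1\cdots\beta_m$ in $\mathcal D_m$ iff every $(\alpha_i,\beta_i)$ is an arc of $\mathcal D_{lr}$. Digraph $\mathcal D^*_m$: the outlet word of $\alpha=\alpha_1\cdots\alpha_m\in V(\mathcal D_m)$ is the binary word $o(\alpha)=o_1\cdots o_m$ with $o_j=0$ if $\alpha_j\in\{b,d,f\}$ and $o_j=1$ if $\alpha_j\in\{a,c,e\}$. Then $V(\mathcal D^*_m)=\{o(\alpha):\alpha\in V(\mathcal D_m)\}$, and there is a (single) arc $v\to w$ in $\mathcal D^*_m$ iff there are $x,y\in V(\mathcal D_m)$ with $x\to y$ in $\mathcal D_m$, $o(x)=v$, $o(y)=w$ (loops allowed). *)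

(* Defs.v *)
From HB Require Import structures.
From mathcomp Require Import all_boot.

Set Implicit Arguments.
Unset Strict Implicit.
Unset Printing Implicit Defensive.

(* Finite digraphs without multiple arcs; loops are allowed. *)
Record digraph := Digraph { vertex :> finType; darc : rel vertex }.

Definition adjacent (G : digraph) : rel G := [rel x y | darc x y || darc y x].

Definition weakly_connected (G : digraph) : Prop :=
  forall x y : G, connect (@adjacent G) x y.

Definition disconnected (G : digraph) : Prop := ~ weakly_connected G.

Definition strongly_connected (G : digraph) : Prop :=
  forall x y : G, connect (@darc G) x y.

Definition weak_components (G : digraph) : {set {set G}} :=
  equivalence_partition (connect (@adjacent G)) [set: G].

Definition induced (G : digraph) (C : {set G}) : digraph :=
  @Digraph {x : G | x \in C} (fun x y => darc (val x) (val y)).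

Inductive letter := La | Lb | Lc | Ld | Le | Lf.

Definition nat_of_letter (x : letter) : nat :=
  match x with La => 0 | Lb => 1 | Lc => 2 | Ld => 3 | Le => 4 | Lf => 5 end.

Definition letter_of_nat (n : nat) : option letter :=
  onth [:: La; Lb; Lc; Ld; Le; Lf] n.

Lemma nat_of_letterK : pcancel nat_of_letter letter_of_nat.
Proof. by case. Qed.

HB.instance Definition _ := Countable.copy letter (pcan_type nat_of_letterK).

Lemma letter_enumP : Finite.axiom [:: La; Lb; Lc; Ld; Le; Lf].
Proof. by case. Qed.

HB.instance Definition _ := isFinite.Build letter letter_enumP.

Definition D_ud : digraph := @Digraph letter [rel x y |
     (x \in [:: La; Lb; Ld]) && (y \in [:: Lb; Lc; Lf])
  || (x \in [:: Lc; Le; Lf]) && (y \in [:: La; Ld; Le])].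

Definition D_lr : digraph := @Digraph letter [rel x y |
     (x \in [:: La; Lc; Le]) && (y \in [:: Ld; Le; Lf])
  || (x \in [:: Lb; Ld; Lf]) && (y \in [:: La; Lb; Lc])].

Definition admissible (w : seq letter) : bool :=
  if w is x :: s then
    [&& x \in [:: La; Ld; Le], path (@darc D_ud) x s
      & last x s \in [:: Lc; Le; Lf]]
  else false.

Definition Dm (m : nat) : digraph :=
  @Digraph {w : m.-tuple letter | admissible w}
    (fun x y => all2 (@darc D_lr) (val x) (val y)).

(* The binary digit 1 is represented by true. *)
Definition outlet (m : nat) (x : Dm m) : m.-tuple bool :=
  [tuple of [seq l \in [:: La; Lc; Le] | l <- val x]].

Definition Dm_star (m : nat) : digraph :=
  @Digraph {v : m.-tuple bool | v \in [set outlet x | x : Dm m]}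
    (fun v w => [exists x : Dm m, [exists y : Dm m,
      [&& darc x y, outlet x == val v & outlet y == val w]]]).

(* Main.v *)
Require Import Defs.
From mathcomp Require Import all_boot.

(** A letter names the two sides through which a path crosses a cell: a is
    down-right, b up-down, c up-right, d down-left, e left-right and f up-left.
    Thus [D_ud] glues cells along a common horizontal border, [D_lr] glues them
    along a common vertical border, and a vertex of [Dm m] is a column of m
    cells that no path leaves through the top or the bottom.  The outlet word
    records which right borders of the column are crossed.

    Strong connectedness.  Reflecting a column [y] in a vertical axis gives
    another column, and [y] can always be followed by its reflection.  If
    [x -> y] then the left borders of [y] match the right borders of [x], so the
    reflection of [y] has the outlet word of [x].  Hence every arc [v -> w] of
    [Dm_star m] comes with an arc [w -> v] ([darc_star_sym]), and in a symmetric
    digraph weak components are strongly connected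
    ([component_strongly_connected]).

    Disconnectedness.  A path crosses an even number (two) of the four borders
    of every cell.  Summed over a column, the inner horizontal borders count
    twice and the outer ones are not crossed, so an even number of left and
    right borders is crossed ([parity_mirror]).  So the parity of the number of
    ones is constant on components ([darc_star_parity]), while the columns
    [e e e ... e] and [a f e ... e] have outlet words [1 1 1 ... 1] and
    [1 0 1 ... 1] of opposite parities. *)

Set Implicit Arguments.
Unset Strict Implicit.
Unset Printing Implicit Defensive.

(** * Symmetric digraphs *)

(** A path that realises weak connectedness is already directed, and all its
    vertices lie in the component of its origin. *)
Lemma component_strongly_connected (G : digraph) :
  symmetric (@darc G) ->
  forall C : {set G}, C \in weak_components G -> strongly_connected (induced C).
Proof.
move=> dsym C /imsetP[x0 _ defC] x y.
have adjE : @adjacent G =2 @darc G.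
  by move=> u v; rewrite /adjacent /= [darc v u]dsym orbb.
have inC u : (u \in C) = connect (@darc G) x0 u.
  by rewrite defC !inE (eq_connect adjE).
have csym : connect_sym (@darc G) by apply: sym_connect_sym.
have: connect (@darc G) (val x) (val y).
  have := valP x; have := valP y; rewrite !inC => x0y x0x.
  by apply: connect_trans x0y; rewrite csym.
case/connectP=> p; elim: p x => [|z p IHp] x /= => [_ /val_inj <- | ].
  exact: connect0.
case/andP=> xz pz lastp.
have Cz : z \in C.
  by rewrite inC (connect_trans _ (connect1 xz)) // -inC (valP x).
exact: connect_trans (@connect1 _ (@darc (induced C)) x (exist _ z Cz) xz)
                     (IHp (exist _ z Cz) pz lastp).
Qed.

(** * Cells and their borders *)

Definition crosses_up (l : letter) : bool := l \in [:: Lb; Lc; Lf].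
Definition crosses_down (l : letter) : bool := l \in [:: La; Lb; Ld].
Definition crosses_right (l : letter) : bool := l \in [:: La; Lc; Le].

(** The reflection in a vertical axis; crossing the left border is therefore
    [crosses_right (mirror l)]. *)
Definition mirror (l : letter) : letter :=
  match l with
  | La => Ld | Ld => La | Lc => Lf | Lf => Lc | Lb => Lb | Le => Le
  end.

Lemma darc_udE (k l : letter) :
  @darc D_ud k l = (crosses_down k == crosses_up l).
Proof. by case: k; case: l. Qed.

Lemma darc_lrE (k l : letter) :
  @darc D_lr k l = (crosses_right k == crosses_right (mirror l)).
Proof. by case: k; case: l. Qed.

Lemma mirrorK : involutive mirror.
Proof. by case. Qed.

Lemma crosses_up_mirror (l : letter) : crosses_up (mirror l) = crosses_up l.
Proof. by case: l. Qed.

Lemma crosses_down_mirror (l : letter) :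
  crosses_down (mirror l) = crosses_down l.
Proof. by case: l. Qed.

(** Exactly two of the four borders of a cell are crossed. *)
Lemma crosses_even (l : letter) :
  crosses_right l (+) crosses_right (mirror l) = crosses_up l (+) crosses_down l.
Proof. by case: l. Qed.

(** * Columns *)

Lemma admissibleE (x : letter) (s : seq letter) :
  admissible (x :: s) =
  [&& ~~ crosses_up x, path (@darc D_ud) x s & ~~ crosses_down (last x s)].
Proof.
have nup l : (l \in [:: La; Ld; Le]) = ~~ crosses_up l by case: l.
have ndown l : (l \in [:: Lc; Le; Lf]) = ~~ crosses_down l by case: l.
by rewrite /= nup ndown.
Qed.

Lemma admissible_mirror (w : seq letter) :
  admissible (map mirror w) = admissible w.
Proof.
case: w => [//|x s]; rewrite map_cons !admissibleE last_map path_map.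
rewrite crosses_up_mirror crosses_down_mirror; congr [&& _, _ & _].
apply: eq_path => k l; rewrite [RHS]darc_udE.
by rewrite [LHS]darc_udE crosses_up_mirror crosses_down_mirror.
Qed.

(** The inner horizontal borders cancel in pairs; only the outer two remain. *)
Lemma parity_path (x : letter) (s : seq letter) :
  path (@darc D_ud) x s ->
  odd (count crosses_right (x :: s))
    (+) odd (count crosses_right (map mirror (x :: s)))
  = crosses_up x (+) crosses_down (last x s).
Proof.
elim: s x => [|y s IHs] x.
  by move=> _; rewrite /= !addn0 !oddb crosses_even.
case/andP; rewrite darc_udE => /eqP xy /IHs {}IHs.
have countS k t : count crosses_right (k :: t)
                  = crosses_right k + count crosses_right t by [].
rewrite map_cons (countS x) (countS (mirror x)) 2!oddD !oddb addbACA.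
by rewrite crosses_even IHs xy -addbA addKb.
Qed.

Lemma parity_mirror (w : seq letter) :
  admissible w ->
  odd (count crosses_right w) = odd (count crosses_right (map mirror w)).
Proof.
case: w => [//|x s]; rewrite admissibleE => /and3P[/negbTE up_x pxs down_s].
have := parity_path pxs; rewrite up_x (negbTE down_s).
by do 2!case: (odd _).
Qed.

Lemma all2_lrE (s t : seq letter) :
  size s = size t ->
  all2 (@darc D_lr) s t
  = (map crosses_right s == map crosses_right (map mirror t)).
Proof.
elim: s t => [|k s IHs] [|l t] // [/IHs {}IHs].
by rewrite !map_cons eqseq_cons -IHs -darc_lrE.
Qed.

(** * Outlet words *)

Lemma outletE (m : nat) (x : Dm m) :
  outlet x = map crosses_right (val x) :> seq bool.
Proof. by []. Qed.

Lemma mirror_column_proof (m : nat) (x : Dm m) :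
  admissible [tuple of map mirror (val x)].
Proof. by rewrite /= admissible_mirror (valP x). Qed.

Definition mirror_column (m : nat) (x : Dm m) : Dm m :=
  exist (fun w : m.-tuple letter => admissible w) _ (mirror_column_proof x).

Lemma mirror_columnK (m : nat) : involutive (@mirror_column m).
Proof.
by move=> x; apply/val_inj/val_inj; rewrite /= (mapK mirrorK).
Qed.

Lemma darc_DmE (m : nat) (x y : Dm m) :
  @darc (Dm m) x y = (outlet x == outlet (mirror_column y)).
Proof.
by rewrite -val_eqE /= all2_lrE ?size_tuple.
Qed.

(** A single column [y] witnesses the arc, since every vertex of [Dm_star m] is
    an outlet word: [v] is read on the left of [y] and [w] on its right. *)
Lemma darc_starP (m : nat) (v w : Dm_star m) :
  reflect (exists2 y : Dm m,
             outlet (mirror_column y) = val v & outlet y = val w)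
          (@darc (Dm_star m) v w).
Proof.
apply: (iffP existsP) => [[x] | [y lv rw]].
  case/existsP=> y /and3P[xy /eqP ox /eqP oy].
  by exists y => //; rewrite -ox; apply/esym/eqP; rewrite -darc_DmE.
have /imsetP[x _ vx] : val v \in [set outlet x | x : Dm m] := valP v.
exists x; apply/existsP; exists y.
by rewrite darc_DmE -vx lv rw !eqxx.
Qed.

Lemma darc_star_sym (m : nat) : symmetric (@darc (Dm_star m)).
Proof.
move=> v w; apply/darc_starP/darc_starP => -[y oy oy'];
  by exists (mirror_column y); rewrite ?mirror_columnK.
Qed.

Lemma darc_star_parity (m : nat) (v w : Dm_star m) :
  @darc (Dm_star m) v w -> odd (count id (val v)) = odd (count id (val w)).
Proof.
case/darc_starP=> y <- <-.
have := parity_mirror (valP y).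
by rewrite !outletE !count_map.
Qed.

Lemma connect_star_parity (m : nat) (v w : Dm_star m) :
  connect (@adjacent (Dm_star m)) v w ->
  odd (count id (val v)) = odd (count id (val w)).
Proof.
apply: (@closed_connect _ _ [pred u : Dm_star m | odd (count id (val u))]).
by move=> u u' /orP[] /darc_star_parity; rewrite !inE.
Qed.

Lemma outlet_in_star (m : nat) (x : Dm m) :
  outlet x \in [set outlet x | x : Dm m].
Proof. exact: imset_f. Qed.

Definition outlet_vertex (m : nat) (x : Dm m) : Dm_star m :=
  exist (fun v : m.-tuple bool => v \in [set outlet x | x : Dm m])
    _ (outlet_in_star x).

(** * Two outlet words of opposite parities *)

(** A cell e crosses no horizontal border, so it can be appended below any
    column. *)
Lemma admissible_cat_e (w : seq letter) (n : nat) :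
  admissible w -> admissible (w ++ nseq n Le).
Proof.
case: w => [//|x s]; rewrite cat_cons !admissibleE cat_path last_cat.
case/and3P=> -> -> /=; elim: n (last x s) => [|n IHn] y down_y //.
have ye : @darc D_ud y Le by rewrite darc_udE (negbTE down_y).
by case/andP: (IHn Le isT) => pe le; apply/andP; split=> //; apply/andP.
Qed.

Theorem theorem3p9 (m : nat) (hm : 2 <= m) :
  disconnected (Dm_star m) /\
  (forall C : {set Dm_star m}, C \in weak_components (Dm_star m) ->
     strongly_connected (induced C)).
Proof.
split; last by apply: component_strongly_connected; apply: darc_star_sym.
case: m hm => [|[|n]] // _ conn.
pose column x y : n.+2.-tuple letter := [tuple of [:: x, y & nseq n Le]].
have col_ee : admissible (column Le Le).
  exact: (@admissible_cat_e [:: Le; Le] n isT).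
have col_af : admissible (column La Lf).
  exact: (@admissible_cat_e [:: La; Lf] n isT).
pose vertex (w : n.+2.-tuple letter) (adm : admissible w) : Dm_star n.+2 :=
  outlet_vertex (exist (fun w : n.+2.-tuple letter => admissible w) w adm).
(* The common tail cancels: only the two top cells, with outlets 1 1 and 1 0,
   matter. *)
have /= := connect_star_parity (conn (vertex _ col_ee) (vertex _ col_af)).
by case: odd.
Qed.
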